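(* Let $\alpha > 1$ be fixed, and for each dimension $d$ let $L \subset \mathcal{B}$ consist of $n = \alpha^d$ independent uniformly random vectors from the unit ball $\mathcal{B} = \{\mathbf{x} \in \mathbb{R}^d : \|\mathbf{x}\| \leq 1\}$. Then, with probability $1 - o(1)$ over the randomness of $L$ (as $d \to \infty$), we have: if $\alpha \leq \sqrt{2}$, then $\operatorname{vol}(\mathcal{V}_L) = \left(\frac{\alpha^2}{4\alpha^2 - 4}\right)^{d/2 + o(d)} \operatorname{vol}(\mathcal{B})$; if $\alpha \geq \sqrt{2}$, then $\operatorname{vol}(\mathcal{V}_L) = \left(\frac{1}{\alpha^2}\right)^{d/2 + o(d)} \operatorname{vol}(\mathcal{B})$.
   Context: For $\mathbf{v} \in \mathbb{R}^d$, $\mathcal{H}_{\mathbf{v}} := \{\mathbf{x} \in \mathbb{R}^d : \|\mathbf{x}\| \leq \|\mathbf{x} - \mathbf{v}\|\}$ (Euclidean norm), and for $L \subset \mathbb{R}^d$ with $\mathbf{0} \notin L$, $\mathcal{V}_L := \bigcap_{\mathbf{v} \in L} \mathcal{H}_{\mathbf{v}}$ (a possibly unbounded convex polytope; its volume may be infinite). Asymptotic notation refers to $d \to \infty$ with $\alpha$ fixed.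
   Formalization: When α² = 4/3 the base α²/(4α²−4) equals 1, so the claim read literally would force vol(V_L) = vol(B) exactly, which has probability 0; there it is read as vol(V_L) = e^{o(d)} vol(B). The number n is α^d rounded to a neighbouring integer. *)

(* Defs.v *)
From HB Require Import structures.
From mathcomp Require Import all_boot all_order all_algebra.
From mathcomp Require Import all_classical all_reals all_analysis.

Set Implicit Arguments.
Unset Strict Implicit.
Unset Printing Implicit Defensive.

Import Order.TTheory GRing.Theory Num.Theory.
Import numFieldNormedType.Exports.

Local Open Scope classical_set_scope.
Local Open Scope ring_scope.

(* Points of R^d are d-tuples: these carry the product of the Borel
   sigma-algebras of the coordinates. *)
Notation euclid R d := (d.-tuple (measurableTypeR R)).

Section lebesgue_measure_tuple.
Context {R : realType}.

Definition consp d (p : measurableTypeR R * euclid R d) : euclid R d.+1 :=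
  [the d.+1.-tuple _ of p.1 :: p.2].

Lemma measurable_consp d : measurable_fun setT (@consp d).
Proof. exact: measurable_cons. Qed.

Definition leb_step d (m : {sigma_finite_measure set (euclid R d) -> \bar R}) :
    set (euclid R d.+1) -> \bar R :=
  pushforward (@lebesgue_measure R \x m)%E (@consp d).

Section leb_step.
Variables (d : nat) (m : {sigma_finite_measure set (euclid R d) -> \bar R}).

Let mm : {measure set (euclid R d.+1) -> \bar R} :=
  measure_function_pushforward__canonical__measure_function_Measure
    (@lebesgue_measure R \x m)%E (@measurable_consp d).

HB.instance Definition _ := Measure.copy (leb_step m) mm.

Let leb_step_sigma_finite : sigma_finite setT (leb_step m).
Proof.
have [F FT Ffin] : sigma_finite setT (@lebesgue_measure R \x m)%E.
  have /sigma_finiteP[F [TF ndF Foo]] := sigma_finiteT (@lebesgue_measure R).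
  have /sigma_finiteP[G [TG ndG Goo]] := sigma_finiteT m.
  exists (fun n => F n `*` G n).
    rewrite -setXTT TF TG predeqE => -[x y]; split.
      move=> [/= [n _ Fnx] [k _ Gky]]; exists (maxn n k) => //; split.
      - by move: x Fnx; exact/subsetPset/ndF/leq_maxl.
      - by move: y Gky; exact/subsetPset/ndG/leq_maxr.
    by move=> [n _ []/= ? ?]; split; exists n.
  move=> k; have [? ?] := Foo k; have [? ?] := Goo k.
  split; first exact: measurableX.
  by rewrite product_measure1E// lte_mul_pinfty// ge0_fin_numE.
pose unc (t : euclid R d.+1) : measurableTypeR R * euclid R d :=
  (thead t, [tuple of behead t]).
have munc : measurable_fun setT unc.
  apply/measurable_fun_pairP; split; last exact: measurable_behead.
  exact: measurable_tnth.
have uncK p : unc (consp p) = p.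
  by case: p => x y; congr pair; exact: val_inj.
exists (fun n => unc @^-1` F n).
  by rewrite -preimage_bigcup -FT preimage_setT.
move=> n; have [mF Foo] := Ffin n; split.
  by rewrite -[X in measurable X]setTI; exact: munc.
rewrite /leb_step /pushforward -comp_preimage.
rewrite (_ : unc \o _ = id) ?preimage_id//.
by apply/funext => p /=.
Qed.

HB.instance Definition _ :=
  Measure_isSigmaFinite.Build _ _ _ (leb_step m) leb_step_sigma_finite.

End leb_step.

Fixpoint lebesgue_tuple d : {sigma_finite_measure set (euclid R d) -> \bar R} :=
  match d with
  | 0 => [the {sigma_finite_measure set (euclid R 0) -> \bar R} of
           \d_([tuple] : euclid R 0)]
  | d'.+1 => leb_step (lebesgue_tuple d')
  end.

Lemma lebesgue_tuple_box d (A : 'I_d -> set (measurableTypeR R)) :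
  (forall i, measurable (A i)) ->
  lebesgue_tuple d [set x | forall i, A i (tnth x i)] =
  (\prod_(i < d) lebesgue_measure (A i))%E.
Proof.
elim: d A => [|d IH] A mA.
  by rewrite big_ord0 /= diracE mem_set//= => -[].
rewrite big_ord_recl -IH; last by move=> i; exact: mA.
pose B : set (euclid R d) := [set x | forall i, A (lift ord0 i) (tnth x i)].
have mB : measurable B.
  rewrite (_ : B = \bigcap_(i in [set: 'I_d])
      (fun x : euclid R d => tnth x i) @^-1` A (lift ord0 i)); last first.
    by apply/seteqP; split => [x Bx i _|x Bx i]; [exact: Bx|exact: (Bx i)].
  apply: fin_bigcap_measurable => // i _.
  by rewrite -[X in measurable X]setTI; exact: measurable_tnth.
rewrite -/B -product_measure1E//= /leb_step /pushforward.
congr (product_measure1 _ _ _); apply/seteqP; split => -[x y] /=.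
  move=> H; split; first by have := H ord0; rewrite tnth0.
  by move=> i; have := H (lift ord0 i); rewrite tnthS.
move=> [/= Ax By] i; case: (unliftP ord0 i) => [j ->|->].
  by rewrite tnthS; exact: By.
by rewrite tnth0.
Qed.

End lebesgue_measure_tuple.

Section euclidean.
Context {R : realType} {d : nat}.
Implicit Types (x y v : euclid R d) (L : set (euclid R d)).

Definition enorm x : R := Num.sqrt (\sum_(i < d) (tnth x i : R) ^+ 2).

Definition esub x y : euclid R d :=
  [tuple ((tnth x i : R) - (tnth y i : R) : measurableTypeR R) | i < d].

Definition unit_ball : set (euclid R d) := [set x | enorm x <= 1].

Definition halfspace v : set (euclid R d) :=
  [set x | enorm x <= enorm (esub x v)].

(* If the origin belongs to L it has no effect: halfspace of it is everything. *)
Definition voronoi L : set (euclid R d) := \bigcap_(v in L) halfspace v.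

End euclidean.

Section random_vectors.
Context {R : realType} {disp : measure_display} {Om : measurableType disp}.
Variable P : probability Om R.
Local Open Scope ereal_scope.

Definition uniform_in d (B : set (euclid R d)) (X : {RV P >-> euclid R d}) :=
  forall A, measurable A ->
    distribution P X A = lebesgue_tuple d (A `&` B) / lebesgue_tuple d B.

Definition mutually_independent {disp' : measure_display}
    {T : measurableType disp'} n (X : 'I_n -> {RV P >-> T}) :=
  forall (J : {set 'I_n}) (A : 'I_n -> set T),
    (forall i, measurable (A i)) ->
    P (\bigcap_(i in [set` J]) (X i @^-1` A i)) =
    \prod_(i in J) P (X i @^-1` A i).

End random_vectors.

(* Probability 1 - o(1) as d tends to infinity, for a sequence of events in
   possibly different probability spaces. *)
Definition with_high_probability (R : realType) (disp : nat -> measure_display)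
    (Om : forall d, measurableType (disp d))
    (P : forall d, probability (Om d) R) (E : forall d, set (Om d)) :=
  (forall d, measurable (E d)) /\ P d (E d) @[d --> \oo] --> 1%E.

(* v = c ^ (d/2 + t) * w with |t| <= e, where e plays the role of the o(d) term.
   For the base c = 1 the expression c ^ (d/2 + o(d)) carries no error term when
   read literally; it is then understood as 1 ^ (d/2) * exp (o(d)). For every
   other c > 0, c ^ (d/2 + o(d)) and c ^ (d/2) * exp (o(d)) mean the same. *)
Definition pow_half_upto (R : realType) (c : R) (d : nat) (e : R)
    (v w : \bar R) :=
  exists2 t : R, `|t| <= e &
    v = ((if c == 1 then expR t else c `^ (d%:R / 2 + t))%:E * w)%E.

(* Main.v *)
Require Import Defs.
From mathcomp Require Import all_boot all_order all_algebra.
From mathcomp Require Import all_classical all_reals all_analysis.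
From mathcomp Require Import measurable_realfun.
From mathcomp Require Import ring lra.

(** A point [x] lies outside the half-space of a uniform [v] when [v] falls in
    the lens [|x - v| < |x|] of the unit ball. Up to [exp (o(d))] this lens
    has the volume of the smallest ball containing it, whose squared radius is
    [|x|^2] if [|x|^2 <= 1/2] and [1 - 1/(4 |x|^2)] otherwise: most of that
    ball is concentrated near the hyperplane orthogonal to [x] through its
    center, and that part is in the lens when the radius is slightly
    decreased. In both regimes of the theorem [c] is the value of [|x|^2] at
    which [n] times the probability of the lens crosses 1.

    For smaller [|x|] the union bound and Tonelli show that the cell misses
    only a small part of the ball of radius [|x|] on average. For larger
    [|x|], independence makes the expected volume of the cell within a shell
    doubly exponentially small. The cell is convex and with high probability
    contains a ball of constant radius around the origin, so reaching beyond
    the shell would force it to contain a ball of constant radius inside the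
    shell; Markov's inequality excludes this. *)

Set Implicit Arguments.
Unset Strict Implicit.
Unset Printing Implicit Defensive.

Import Order.TTheory GRing.Theory Num.Theory.
Import numFieldNormedType.Exports.

Local Open Scope classical_set_scope.
Local Open Scope ring_scope.

(** * Rescaling the Lebesgue measure *)

Section rescale1.
Context {R : realType}.
Implicit Types (a s : R).
Local Notation mu := (@lebesgue_measure R).

Definition rescale1 a s (x : measurableTypeR R) : measurableTypeR R :=
  ((x : R) - a) / s.

Lemma measurable_rescale1 a s : measurable_fun setT (rescale1 a s).
Proof. by apply: measurable_funM => //; exact: measurable_funB. Qed.

Lemma rescale1_preimage_itvoc a s (u v : R) : 0 < s ->
  rescale1 a s @^-1` `]u, v]%classic = `]u * s + a, v * s + a]%classic.
Proof.
move=> s0; apply/seteqP; split=> x; rewrite /rescale1/= !in_itv/=;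
  by rewrite ltr_pdivlMr// ler_pdivrMr// ltrBrDr lerBlDr.
Qed.

Lemma lebesgue_measure_rescale1 a s (A : set (measurableTypeR R)) : 0 < s ->
  measurable A -> pushforward mu (rescale1 a s) A = (s%:E * mu A)%E.
Proof.
move=> s0 mA; have si0 : 0 <= s^-1 by rewrite invr_ge0 ltW.
suff -> : mu A = mscale (NngNum si0) (pushforward mu (rescale1 a s)) A.
- exact: measurable_rescale1.
- by move=> mr; rewrite /mscale/= muleA -EFinM divff ?mul1e// gt_eqF.
move=> mr; apply: lebesgue_measure_unique => //= _ [[u v]] _ <-.
rewrite /mscale/= /pushforward rescale1_preimage_itvoc//.
rewrite !lebesgue_measure_itv/= !lte_fin ltrD2r ltr_pM2r//.
case: ifPn => _; last by rewrite mule0.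
by rewrite -!EFinD -EFinM; congr EFin; field; rewrite gt_eqF.
Qed.

Lemma ge0_integral_rescale1 a s (g : measurableTypeR R -> \bar R) : 0 < s ->
  measurable_fun setT g -> (forall x, 0 <= g x)%E ->
  (\int[mu]_x g (rescale1 a s x) = s%:E * \int[mu]_x g x)%E.
Proof.
move=> s0 mg g0; have mr := measurable_rescale1 a s.
rewrite -[LHS](@ge0_integral_pushforward _ _ _ _ _ _ mr mu setT)//.
rewrite -[s]/((NngNum (ltW s0))%:num) -ge0_integral_mscale//.
by apply: eq_measure_integral => A mA _; exact: lebesgue_measure_rescale1.
Qed.

End rescale1.

Section rescale.
Context {R : realType}.

Definition rescale d (a : euclid R d) (s : R) (x : euclid R d) : euclid R d :=
  [tuple rescale1 (tnth a i) s (tnth x i) | i < d].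

Lemma rescale_consp d (a : euclid R d.+1) s p :
  rescale a s (consp p) =
  consp (rescale1 (thead a) s p.1, rescale [tuple of behead a] s p.2).
Proof.
apply: eq_from_tnth => i; rewrite tnth_mktuple.
case: (unliftP ord0 i) => [j ->|->]; last by rewrite !tnth0.
rewrite !tnthS tnth_mktuple tnth_behead; congr (rescale1 (tnth _ _) _ _).
by apply: val_inj; rewrite /= inordK// ltnS.
Qed.

Lemma lebesgue_tuple_recl d (A : set (euclid R d.+1)) :
  lebesgue_tuple d.+1 A = (\int[lebesgue_measure]_x
    lebesgue_tuple d (xsection (@consp R d @^-1` A) x))%E.
Proof. by []. Qed.

Lemma lebesgue_tuple_rescale d (a : euclid R d) s (A : set (euclid R d)) :
  0 < s -> measurable A ->
  lebesgue_tuple d (rescale a s @^-1` A) = ((s ^+ d)%:E * lebesgue_tuple d A)%E.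
Proof.
move=> s0; elim: d a A => [|d IH] a A mA.
  rewrite expr0 mul1e; congr (lebesgue_tuple 0 _).
  by apply/seteqP; split=> x /=; rewrite (tuple0 (rescale _ _ _)) (tuple0 x).
have mAc : measurable (@consp R d @^-1` A).
  by rewrite -[X in measurable X]setTI; exact: measurable_consp.
pose F x := lebesgue_tuple d (xsection (@consp R d @^-1` A) x).
have mF : measurable_fun setT F :=
  measurable_fun_xsection (lebesgue_tuple d) mAc.
rewrite !lebesgue_tuple_recl.
transitivity (\int[lebesgue_measure]_x
    ((s ^+ d)%:E * F (rescale1 (thead a) s x)))%E.
  apply: eq_integral => x _; rewrite -(IH [tuple of behead a]); last first.
    exact: measurable_xsection.
  congr (lebesgue_tuple d _).
  by apply/seteqP; split=> y; rewrite /xsection/= !inE/= rescale_consp.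
rewrite ge0_integralZl//=; last 2 first.
- exact: measurableT_comp mF (measurable_rescale1 _ _).
- by rewrite lee_fin exprn_ge0// ltW.
by rewrite ge0_integral_rescale1// muleA -EFinM -exprSr.
Qed.

End rescale.

(** * Euclidean geometry of tuples *)

Section euclid_geometry.
Context {R : realType} {d : nat}.
Implicit Types (x y v a : euclid R d) (s t : R).

Definition dot x y : R := \sum_(i < d) (tnth x i : R) * (tnth y i : R).

Definition escale t x : euclid R d :=
  [tuple (t * (tnth x i : R) : measurableTypeR R) | i < d].

Definition ezero : euclid R d := [tuple (0 : measurableTypeR R) | i < d].

Lemma dotC x y : dot x y = dot y x.
Proof. by apply: eq_bigr => i _; rewrite mulrC. Qed.

Lemma dotZr t x y : dot x (escale t y) = t * dot x y.
Proof.
by rewrite /dot mulr_sumr; apply: eq_bigr => i _; rewrite tnth_mktuple mulrCA.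
Qed.

Lemma dotZl t x y : dot (escale t x) y = t * dot x y.
Proof. by rewrite dotC dotZr dotC. Qed.

Lemma dotBl x y v : dot (esub x y) v = dot x v - dot y v.
Proof.
by rewrite /dot -sumrB; apply: eq_bigr => i _; rewrite tnth_mktuple mulrBl.
Qed.

Lemma dotBr v x y : dot v (esub x y) = dot v x - dot v y.
Proof. by rewrite dotC dotBl !(dotC v). Qed.

Lemma esubx0 x : esub x ezero = x.
Proof. by apply: eq_from_tnth => i; rewrite !tnth_mktuple subr0. Qed.

Lemma enorm_ge0 x : 0 <= enorm x.
Proof. exact: sqrtr_ge0. Qed.

Lemma sqr_enorm x : enorm x ^+ 2 = dot x x.
Proof.
rewrite sqr_sqrtr; last by apply: sumr_ge0 => i _; exact: sqr_ge0.
by apply: eq_bigr => i _; rewrite expr2.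
Qed.

Lemma sqr_enormB x y :
  enorm (esub x y) ^+ 2 = enorm x ^+ 2 - 2 * dot x y + enorm y ^+ 2.
Proof. by rewrite !sqr_enorm dotBl !dotBr (dotC y x); ring. Qed.

Lemma enormZ t x : enorm (escale t x) = `|t| * enorm x.
Proof.
apply/eqP; rewrite -(eqrXn2 (n := 2)) ?mulr_ge0 ?enorm_ge0//.
by rewrite exprMn real_normK ?num_real// !sqr_enorm dotZl dotZr mulrA -expr2.
Qed.

Lemma enorm0_eq0 x : enorm x = 0 -> x = ezero.
Proof.
move=> x0; apply: eq_from_tnth => i; rewrite tnth_mktuple.
have : dot x x == 0 by rewrite -sqr_enorm x0 expr0n.
rewrite psumr_eq0 => [/allP/(_ i (mem_index_enum _))|j _].
  by rewrite /= mulf_eq0 orbb => /eqP.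
by rewrite -expr2 sqr_ge0.
Qed.

Lemma dot_le_enorm x y : dot x y <= enorm x * enorm y.
Proof.
have [x0|x0] := eqVneq (enorm x) 0.
  rewrite x0 mul0r (enorm0_eq0 x0) /dot big1// => i _.
  by rewrite tnth_mktuple mul0r.
have [y0|y0] := eqVneq (enorm y) 0.
  rewrite y0 mulr0 (enorm0_eq0 y0) /dot big1// => i _.
  by rewrite tnth_mktuple mulr0.
have xy0 : 0 < enorm x * enorm y.
  by rewrite mulr_gt0// lt_neqAle eq_sym ?x0 ?y0 enorm_ge0.
have := sqr_ge0 (enorm (esub (escale (enorm y) x) (escale (enorm x) y))).
rewrite sqr_enormB dotZl dotZr !enormZ !ger0_norm ?enorm_ge0//.
nra.
Qed.

Lemma ler_dist_enorm x y : `|enorm x - enorm y| <= enorm (esub x y).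
Proof.
rewrite -ler_sqr ?nnegrE ?enorm_ge0// real_normK ?num_real// sqr_enormB.
by have := dot_le_enorm x y; lra.
Qed.

Lemma measurable_enorm : measurable_fun setT (@enorm R d).
Proof.
apply: measurableT_comp.
  by apply: continuous_measurable_fun; exact: sqrt_continuous.
by apply: measurable_sum => i; apply: measurable_funX; exact: measurable_tnth.
Qed.

Lemma measurable_esub dp (T : measurableType dp) (f g : T -> euclid R d) :
  measurable_fun setT f -> measurable_fun setT g ->
  measurable_fun setT (fun w => esub (f w) (g w)).
Proof.
move=> mf mg; apply/measurable_fun_tnthP => i.
rewrite [_ \o _](_ : _ = fun w => (tnth (f w) i : R) - tnth (g w) i).
  by apply: measurable_funB; exact: measurableT_comp (measurable_tnth i) _.
by apply/funext => w; exact: tnth_mktuple.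
Qed.

End euclid_geometry.

(** * Volumes of balls *)

Section comparison_sets.
Context {R : realType} dp (T : measurableType dp) (f g : T -> R).
Hypotheses (mf : measurable_fun setT f) (mg : measurable_fun setT g).

Lemma measurable_set_ler : measurable [set w | f w <= g w].
Proof.
have := measurable_fun_ler mf mg => /(_ measurableT [set true]).
by rewrite setTI; apply.
Qed.

Lemma measurable_set_ltr : measurable [set w | f w < g w].
Proof.
have := measurable_fun_ltr mf mg => /(_ measurableT [set true]).
by rewrite setTI; apply.
Qed.

End comparison_sets.

Section eball.
Context {R : realType} {d : nat}.
Implicit Types (x a : euclid R d) (s q : R).

Definition eball a s : set (euclid R d) := [set x | enorm (esub x a) <= s].

Definition cube q : set (euclid R d) :=
  [set x | forall i, `|(tnth x i : R)| <= q].

Lemma measurable_eball a s : measurable (eball a s).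
Proof.
apply: measurable_set_ler => //; apply: measurableT_comp measurable_enorm _.
exact: measurable_esub.
Qed.

Lemma eball_ezero s : eball ezero s = [set x | enorm x <= s].
Proof. by apply/seteqP; split=> x; rewrite /eball/= esubx0. Qed.

Lemma unit_ballE : unit_ball = eball ezero 1.
Proof. by rewrite eball_ezero. Qed.

Lemma measurable_unit_ball : measurable (@unit_ball R d).
Proof. by rewrite unit_ballE; exact: measurable_eball. Qed.

Lemma eball_rescale a s : 0 < s -> eball a s = rescale a s @^-1` unit_ball.
Proof.
move=> s0; have rescaleE x : rescale a s x = escale s^-1 (esub x a).
  by apply: eq_from_tnth => i; rewrite !tnth_mktuple /rescale1 mulrC.
apply/seteqP; split=> x; rewrite /eball /unit_ball/= rescaleE enormZ;
  by rewrite gtr0_norm ?invr_gt0// mulrC ler_pdivrMr// mul1r.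
Qed.

Lemma cubeE q :
  cube q = [set x | forall i, `[- q, q]%classic (tnth x i : measurableTypeR R)].
Proof.
by apply/seteqP; split=> x xq i; have := xq i; rewrite /= in_itv/= ler_norml.
Qed.

Lemma measurable_cube q : measurable (cube q).
Proof.
rewrite (_ : cube q = \bigcap_(i in [set: 'I_d])
    [set x : euclid R d | `|(tnth x i : R)| <= q]); last first.
  by apply/seteqP; split=> [x xq i _|x xq i]; exact: xq.
apply: fin_bigcap_measurable => // i _; apply: measurable_set_ler => //.
by apply: measurableT_comp => //; exact: measurable_tnth.
Qed.

Lemma lebesgue_cube q : 0 < q -> lebesgue_tuple d (cube q) = ((2 * q) ^+ d)%:E.
Proof.
move=> q0; rewrite cubeE (lebesgue_tuple_box (A := fun=> `[- q, q]%classic))//.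
under eq_bigr => i _.
  rewrite lebesgue_measure_itv/= lte_fin ifT; last by lra.
  rewrite -EFinB opprK -mulr2n -mulr_natl; over.
by rewrite prodEFin prodr_const card_ord.
Qed.

Lemma unit_ball_sub_cube : @unit_ball R d `<=` cube 1.
Proof.
move=> x x1 i; rewrite -ler_sqr ?nnegrE// expr1n real_normK ?num_real//.
apply: (@le_trans _ _ (enorm x ^+ 2)); last by rewrite expr_le1 ?enorm_ge0.
rewrite sqr_enorm /dot (bigD1 i)//= -expr2 lerDl.
by apply: sumr_ge0 => j _; rewrite -expr2 sqr_ge0.
Qed.

Lemma cube_sub_unit_ball : cube d.+1%:R^-1 `<=` @unit_ball R d.
Proof.
move=> x xq; rewrite /unit_ball/= -(expr_le1 (n := 2)) ?enorm_ge0// sqr_enorm.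
apply: (@le_trans _ _ (\sum_(i < d) d.+1%:R^-1)).
  apply: ler_sum => i _; rewrite -expr2 -real_normK ?num_real//.
  apply: le_trans (xq i); rewrite expr2 ler_piMr//.
  by apply: le_trans (xq i) _; rewrite invf_le1 ?ler1n.
by rewrite sumr_const card_ord -[leLHS]mulr_natl ler_pdivrMr// mul1r ler_nat.
Qed.

Definition ball_vol : R := fine (lebesgue_tuple d (@unit_ball R d)).

Lemma lebesgue_unit_ball : lebesgue_tuple d (@unit_ball R d) = ball_vol%:E.
Proof.
rewrite fineK// ge0_fin_numE//.
apply: (@le_lt_trans _ _ (lebesgue_tuple d (cube 1))); last first.
  by rewrite lebesgue_cube ?ltry.
by apply: le_measure unit_ball_sub_cube; rewrite inE;
  [exact: measurable_unit_ball|exact: measurable_cube].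
Qed.

Lemma ball_vol_gt0 : 0 < ball_vol.
Proof.
rewrite -lte_fin -lebesgue_unit_ball.
apply: (@lt_le_trans _ _ (lebesgue_tuple d (cube d.+1%:R^-1))).
  by rewrite lebesgue_cube ?lte_fin ?exprn_gt0 ?mulr_gt0 ?invr_gt0.
by apply: le_measure cube_sub_unit_ball; rewrite inE;
  [exact: measurable_cube|exact: measurable_unit_ball].
Qed.

Lemma lebesgue_eball a s : 0 < s ->
  lebesgue_tuple d (eball a s) = (s ^+ d * ball_vol)%:E.
Proof.
move=> s0; rewrite eball_rescale// lebesgue_tuple_rescale//.
  by rewrite lebesgue_unit_ball.
exact: measurable_unit_ball.
Qed.

End eball.
Arguments ball_vol R d : clear implicits.

(** * Lenses *)

Section lens_rate.
Context {R : realFieldType}.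
Implicit Types a c : R.

(* For [c = |x|^2], the smallest ball containing the lens of [x] is centered at
   [lens_coef c * x] and has squared radius [lens_rate c]. *)
Definition lens_coef c : R := if c <= 1 / 2 then 1 else (2 * c)^-1.
Definition lens_rate c : R := (2 - lens_coef c) * lens_coef c * c.

Lemma lens_coefP c :
  [/\ 0 < lens_coef c, lens_coef c <= 1, 2 * lens_coef c * c <= 1 &
      lens_coef c = 1 \/ 2 * lens_coef c * c = 1].
Proof.
rewrite /lens_coef; case: (lerP c (1 / 2)) => hc.
  by split=> //; [lra|left].
have e : 2 * (2 * c)^-1 * c = 1 by field; lra.
by split; [rewrite invr_gt0|rewrite invf_le1| |right]; lra.
Qed.

Lemma lens_rateE c :
  lens_rate c = if c <= 1 / 2 then c else 1 - (4 * c)^-1.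
Proof.
rewrite /lens_rate /lens_coef; case: (lerP c (1 / 2)) => hc; first by ring.
by field; lra.
Qed.

Lemma lens_rate_gt0 c : 0 < c -> 0 < lens_rate c.
Proof.
move=> c0; have [k0 k1 _ _] := lens_coefP c.
by rewrite /lens_rate !mulr_gt0//; lra.
Qed.

Lemma lens_rate_homo_lt : {homo lens_rate : c c' / c < c'}.
Proof.
move=> c c' cc'; rewrite !lens_rateE.
case: (lerP c (1 / 2)) => hc; case: (lerP c' (1 / 2)) => hc' //; last 2 first.
- lra.
- by rewrite ltrD2l ltrN2 ltf_pV2 ?posrE; lra.
have : (4 * c')^-1 < 2^-1 by rewrite ltf_pV2 ?posrE; lra.
lra.
Qed.

Lemma lens_rate_homo_le : {homo lens_rate : c c' / c <= c'}.
Proof. exact: (ltW_homo lens_rate_homo_lt). Qed.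

Lemma lens_rate_critical_le2 a : 1 < a -> a <= 2 ->
  a * lens_rate (a / (4 * a - 4)) = 1.
Proof.
move=> a1 a2; rewrite lens_rateE; case: ifPn => [|_]; last by field; lra.
rewrite ler_pdivrMr; last by lra.
by move=> a2'; have -> : a = 2; [lra|field].
Qed.

Lemma lens_rate_critical_ge2 a : 2 <= a -> a * lens_rate (1 / a) = 1.
Proof.
move=> a2; rewrite lens_rateE ifT; first by field; lra.
by rewrite !div1r lef_pV2 ?posrE; lra.
Qed.

End lens_rate.

Section lens.
Context {R : realType} {d : nat}.
Implicit Types (x v : euclid R d) (r s t e : R).
Local Notation vol := (lebesgue_tuple d).
Local Notation bv := (ball_vol R d).

Definition lens x : set (euclid R d) :=
  [set v | enorm (esub x v) < enorm x] `&` unit_ball.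

Lemma lensP x v : lens x v <-> enorm v ^+ 2 < 2 * dot x v /\ enorm v <= 1.
Proof.
have -> : (enorm v ^+ 2 < 2 * dot x v) = (enorm (esub x v) < enorm x).
  by rewrite -[RHS]ltr_sqr ?nnegrE ?enorm_ge0// sqr_enormB; lra.
by [].
Qed.

Lemma measurable_lens x : measurable (lens x).
Proof.
apply: measurableI; last exact: measurable_unit_ball.
apply: measurable_set_ltr => //; apply: measurableT_comp measurable_enorm _.
exact: measurable_esub.
Qed.

Lemma lens_escale t x : 0 <= t <= 1 -> lens (escale t x) `<=` lens x.
Proof.
move=> t01 v /lensP[]; rewrite dotZl => vx v1; apply/lensP; split=> //.
have := sqr_ge0 (enorm v); nra.
Qed.

Lemma lens_sub_eball x :
  lens x `<=` eball (escale (lens_coef (enorm x ^+ 2)) x)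
                    (Num.sqrt (lens_rate (enorm x ^+ 2))).
Proof.
move=> v /lensP[vx v1].
set c := enorm x ^+ 2; rewrite /eball/=.
have [k0 k1 _ kc] := lens_coefP c; set k := lens_coef c in k0 k1 kc *.
rewrite -[leLHS]ger0_norm ?enorm_ge0// -sqrtr_sqr ler_wsqrtr// /lens_rate -/k.
rewrite sqr_enormB enormZ dotZr (gtr0_norm k0) exprMn -/c (dotC v x).
have v2 : enorm v ^+ 2 <= 1 by rewrite expr_le1 ?enorm_ge0.
by case: kc => kc; [rewrite kc; lra|nra].
Qed.

Lemma lebesgue_lens_le x : (vol (lens x) <= bv%:E)%E.
Proof.
rewrite -lebesgue_unit_ball; apply: le_measure; rewrite ?inE.
- exact: measurable_lens.
- exact: measurable_unit_ball.
- by move=> v [].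
Qed.

Definition lens_prob x : R := fine (vol (lens x)) / bv.

Lemma lebesgue_lens x : vol (lens x) = (lens_prob x * bv)%:E.
Proof.
rewrite /lens_prob divfK ?gt_eqF ?ball_vol_gt0// fineK// ge0_fin_numE//.
exact: le_lt_trans (lebesgue_lens_le x) (ltry _).
Qed.

Lemma lens_prob_le1 x : lens_prob x <= 1.
Proof.
rewrite -(ler_pM2r (@ball_vol_gt0 R d)) mul1r -lee_fin -lebesgue_lens.
exact: lebesgue_lens_le.
Qed.

Lemma lens_prob_escale t x :
  0 <= t <= 1 -> lens_prob (escale t x) <= lens_prob x.
Proof.
move=> t01; rewrite -(ler_pM2r (@ball_vol_gt0 R d)) -lee_fin -!lebesgue_lens.
by apply: le_measure (lens_escale t01); rewrite inE; exact: measurable_lens.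
Qed.

Lemma lens_prob_le x r : enorm x <= r ->
  lens_prob x <= Num.sqrt (lens_rate (r ^+ 2)) ^+ d.
Proof.
move=> xr.
have [x0|x0] := eqVneq (enorm x) 0.
  have -> : lens_prob x = 0; last by rewrite exprn_ge0 ?sqrtr_ge0.
  rewrite /lens_prob (_ : lens x = set0) ?measure0 ?mul0r//.
  by rewrite -subset0 => v []; rewrite /= x0 ltNge enorm_ge0.
have x_gt0 : 0 < enorm x by rewrite lt_neqAle eq_sym x0 enorm_ge0.
apply: (@le_trans _ _ (Num.sqrt (lens_rate (enorm x ^+ 2)) ^+ d)); last first.
  rewrite lerXn2r ?nnegrE ?sqrtr_ge0// ler_wsqrtr// lens_rate_homo_le//.
  by rewrite lerXn2r ?nnegrE ?enorm_ge0// (le_trans (enorm_ge0 x)).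
rewrite -(ler_pM2r (@ball_vol_gt0 R d)) -lee_fin -lebesgue_lens.
rewrite -(lebesgue_eball (escale (lens_coef (enorm x ^+ 2)) x)); last first.
  by rewrite sqrtr_gt0 lens_rate_gt0 ?exprn_gt0.
by apply: le_measure (@lens_sub_eball x); rewrite inE;
  [exact: measurable_lens|exact: measurable_eball].
Qed.

(* Outside the slab [|<v, x> - k |x|^2| <= e |x|^2], the ball is covered by two
   balls of smaller radius, so most of its volume lies in the slab. *)
Lemma eball_sub_lens_eballs x s s' e :
  let k := lens_coef (enorm x ^+ 2) in
  0 <= e -> 0 <= s' ->
  s ^+ 2 + 2 * e * enorm x ^+ 2 < lens_rate (enorm x ^+ 2) ->
  s ^+ 2 - e ^+ 2 * enorm x ^+ 2 <= s' ^+ 2 ->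
  eball (escale k x) s `<=`
    lens x `|` (eball (escale (k + e) x) s' `|` eball (escale (k - e) x) s').
Proof.
move=> k e0 s'0; rewrite /lens_rate -/k; set c := enorm x ^+ 2.
have c0 : 0 <= c by exact: sqr_ge0.
have [k0 k1 kc _] := lens_coefP c; rewrite -/k in k0 k1 kc.
move=> sc ss' v; rewrite /eball/= => vs.
have sqr_dist t : enorm (esub v (escale t x)) ^+ 2 =
    enorm v ^+ 2 - 2 * t * dot x v + t ^+ 2 * c.
  rewrite sqr_enormB enormZ dotZr exprMn real_normK ?num_real// (dotC v x).
  by rewrite -/c; ring.
have {vs} : enorm (esub v (escale k x)) ^+ 2 <= s ^+ 2.
  by rewrite lerXn2r ?nnegrE ?enorm_ge0// (le_trans (enorm_ge0 _) vs).
have eballs' t : enorm (esub v (escale t x)) ^+ 2 <= s' ^+ 2 ->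
    enorm (esub v (escale t x)) <= s'.
  by rewrite ler_sqr ?nnegrE ?enorm_ge0.
rewrite sqr_dist => vs.
have [above|?] := ltP ((k + e) * c) (dot x v).
  by right; left; apply: eballs'; rewrite sqr_dist; nra.
have [below|?] := ltP (dot x v) ((k - e) * c).
  by right; right; apply: eballs'; rewrite sqr_dist; nra.
left; apply/lensP; split; first by nra.
by rewrite -(expr_le1 (n := 2)) ?enorm_ge0//; nra.
Qed.

Lemma lens_prob_ge x s s' e : 0 < s -> 0 < s' -> 0 <= e ->
  s ^+ 2 + 2 * e * enorm x ^+ 2 < lens_rate (enorm x ^+ 2) ->
  s ^+ 2 - e ^+ 2 * enorm x ^+ 2 <= s' ^+ 2 ->
  s ^+ d - 2 * s' ^+ d <= lens_prob x.
Proof.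
move=> s0 s'0 e0 sc ss'.
set k := lens_coef (enorm x ^+ 2).
have sub := eball_sub_lens_eballs e0 (ltW s'0) sc ss'; rewrite -/k in sub.
rewrite lerBlDr -(ler_pM2r (@ball_vol_gt0 R d)) mulrDl -lee_fin EFinD.
rewrite -lebesgue_lens -(lebesgue_eball (escale k x) s0).
have mB a q : measurable (eball a q : set (euclid R d)).
  exact: measurable_eball.
have mL := measurable_lens x.
apply: le_trans (le_measure _ _ _ sub) _; rewrite ?inE//.
  by apply: measurableU => //; exact: measurableU.
apply: le_trans (measureU2 _ _ _) _ => //; first exact: measurableU.
apply: leeD => //; apply: le_trans (measureU2 _ _ _) _ => //.
have vB a : (vol (eball a s') <= (s' ^+ d * bv)%:E)%E by rewrite lebesgue_eball.
by rewrite -(mulrA 2) mulr_natl mulr2n EFinD; apply: leeD (vB _) (vB _).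
Qed.

End lens.

Lemma exists_slab_width (R : rcfType) (c s q : R) :
  0 < c -> 0 < s -> s ^+ 2 < q ->
  exists e s', [/\ 0 <= e, 0 < s' < s, s ^+ 2 + 2 * e * c < q &
                   s ^+ 2 - e ^+ 2 * c <= s' ^+ 2].
Proof.
move=> c0 s0 sq; pose e := (q - s ^+ 2) / (4 * c).
have s20 : 0 < s ^+ 2 by rewrite exprn_gt0.
have e0 : 0 < e by rewrite divr_gt0 ?mulr_gt0 ?subr_gt0.
have ec : e * c = (q - s ^+ 2) / 4 by rewrite /e; field; lra.
pose b := Num.max (s ^+ 2 - e ^+ 2 * c) (s ^+ 2 / 2).
have b0 : 0 < b by rewrite lt_max divr_gt0 ?orbT.
have bs : b < s ^+ 2.
  rewrite gt_max gtrBl mulr_gt0 ?exprn_gt0//=; lra.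
exists e, (Num.sqrt b); split; [exact: ltW| |by rewrite -mulrA ec; lra|].
  by rewrite sqrtr_gt0 b0 -[ltRHS]gtr0_norm// -sqrtr_sqr ltr_sqrt.
by rewrite sqr_sqrtr ?(ltW b0)// le_max lexx.
Qed.

Lemma near_lens_prob_ge (R : realType) (r s : R) : 0 < r -> 0 < s ->
  s ^+ 2 < lens_rate (r ^+ 2) ->
  \forall d \near \oo, forall x : euclid R d, r <= enorm x ->
    s ^+ d / 2 <= lens_prob x.
Proof.
move=> r0 s0 sr.
have [e [s' [e0 /andP[s'0 s's] se ss']]] :=
  exists_slab_width (exprn_gt0 2 r0) s0 sr.
have ratio1 : `|s' / s| < 1 by rewrite gtr0_norm ?divr_gt0 ?ltr_pdivrMr ?mul1r.
near=> d => x rx; have x0 : 0 < enorm x by exact: lt_le_trans rx.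
pose y := escale (r / enorm x) x.
have yr : enorm y = r.
  by rewrite enormZ ger0_norm ?divr_ge0 ?divfK ?gt_eqF// ltW.
have lens_yx : lens_prob y <= lens_prob x.
  by apply: lens_prob_escale; rewrite divr_ge0 ?ler_pdivrMr ?mul1r ?rx ?ltW.
have lens_y : s ^+ d - 2 * s' ^+ d <= lens_prob y.
  by apply: (lens_prob_ge s0 s'0 e0); rewrite yr.
apply: le_trans lens_yx; apply: le_trans lens_y.
have : (s' / s) ^+ d <= 1 / 4.
  by near: d; apply: cvgr_le (cvg_expr ratio1) _ _; rewrite divr_gt0.
rewrite expr_div_n ler_pdivrMr ?exprn_gt0//; lra.
Unshelve. all: by end_near. Qed.

(** * Geometry of Voronoi cells *)

Section voronoi.
Context {R : realType} {d : nat}.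
Implicit Types (x y z v : euclid R d) (L : set (euclid R d)) (m r t : R).

Lemma halfspaceP v x : halfspace v x <-> 2 * dot x v <= enorm v ^+ 2.
Proof.
rewrite /halfspace/= -ler_sqr ?nnegrE ?enorm_ge0// sqr_enormB.
by split=> ?; lra.
Qed.

(* By convexity the cell contains the cone with apex [z] over the ball of radius
   [m / 2] around the origin. *)
Lemma voronoi_eball L m t z : 0 <= t <= 1 -> (forall v, L v -> m <= enorm v) ->
  voronoi L z -> eball (escale t z) ((1 - t) * m / 2) `<=` voronoi L.
Proof.
move=> t01 Lm Vz y yz v Lv; apply/halfspaceP.
have zv : 2 * dot z v <= enorm v ^+ 2 by exact/halfspaceP/Vz.
have v0 := enorm_ge0 v; have mv := Lm _ Lv.
have uv : 2 * dot (esub y (escale t z)) v <= (1 - t) * enorm v ^+ 2.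
  have cs := dot_le_enorm (esub y (escale t z)) v.
  have : enorm (esub y (escale t z)) * enorm v <= (1 - t) * m / 2 * enorm v.
    exact: ler_wpM2r.
  have : (1 - t) * m * enorm v <= (1 - t) * enorm v ^+ 2.
    by rewrite -mulrA ler_wpM2l ?subr_ge0 ?expr2 ?ler_wpM2r//; case/andP: t01.
  lra.
have : t * (2 * dot z v) <= t * enorm v ^+ 2.
  by apply: ler_wpM2l zv; case/andP: t01.
by move: uv; rewrite dotBl dotZl; lra.
Qed.

Definition shell r1 r2 : set (euclid R d) := [set y | r1 <= enorm y <= r2].

Lemma voronoi_shell_eball L m t r z : 0 < r -> 0 <= t <= 1 -> 0 <= m <= 2 * r ->
  (forall v, L v -> m <= enorm v) -> voronoi L z -> r <= enorm z ->
  exists a, eball a (t * m / 2) `<=`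
    voronoi L `&` shell ((1 - t) * r - t * m / 2) r.
Proof.
move=> r0 /andP[t0 t1] /andP[m0 mr] Lm Vz rz.
have z0 : 0 < enorm z by exact: lt_le_trans rz.
pose k := (1 - t) * (r / enorm z); pose a := escale k z.
have rz0 : 0 <= r / enorm z by rewrite divr_ge0 ?ltW.
have rz1 : r / enorm z <= 1 by rewrite ler_pdivrMr ?mul1r.
have k0 : 0 <= k by rewrite mulr_ge0 ?subr_ge0.
have kt : k <= 1 - t by rewrite ler_piMr ?subr_ge0.
have ar : enorm a = (1 - t) * r.
  by rewrite enormZ ger0_norm// /k -mulrA divfK ?gt_eqF.
exists a => y ya; split.
  apply: (voronoi_eball _ Lm Vz (t := k)); first by rewrite k0; lra.
  apply: le_trans ya _; rewrite ler_pM2r ?invr_gt0// ler_wpM2r//; lra.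
have : `|enorm y - enorm a| <= t * m / 2 := le_trans (ler_dist_enorm y a) ya.
by rewrite ler_distl ar => /andP[? ?]; apply/andP; split; nra.
Qed.

Lemma measurable_shell r1 r2 : measurable (shell r1 r2).
Proof.
rewrite (_ : shell r1 r2 = [set y | r1 <= enorm y] `&` [set y | enorm y <= r2]).
  by apply: measurableI; apply: measurable_set_ler => //;
    exact: measurable_enorm.
by apply/seteqP; split=> y /andP.
Qed.

Lemma lebesgue_shell_le r1 r2 : 0 < r2 ->
  (lebesgue_tuple d (shell r1 r2) <= (r2 ^+ d * ball_vol R d)%:E)%E.
Proof.
move=> r20; rewrite -(lebesgue_eball ezero r20).
apply: le_measure; rewrite ?inE.
- exact: measurable_shell.
- exact: measurable_eball.
- by rewrite eball_ezero => y /andP[].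
Qed.

End voronoi.

(** * A union bound and Markov's inequality for sections *)

Lemma measure_fin_bigcup_le (R : realType) dp (T : measurableType dp)
    (mu : {measure set T -> \bar R}) (I : finType) (A : I -> set T) :
  (forall i, measurable (A i)) -> (mu (\bigcup_i A i) <= \sum_i mu (A i))%E.
Proof.
move=> mA; have -> : \bigcup_i A i = \big[setU/set0]_i A i.
  rewrite -bigcup_seq; apply/seteqP; split=> x [i _ Aix]; exists i => //=.
  exact: mem_index_enum.
elim: (index_enum I) => [|i s IH]; first by rewrite !big_nil measure0.
rewrite !big_cons; apply: le_trans (measureU2 _ _ _) (leeD _ IH) => //.
exact: bigsetU_measurable.
Qed.

(* Tonelli's theorem turns the bound on the sections over [S] into a bound on
   the integral of the other sections; then Markov's inequality. *)
Lemma markov_xsection (R : realType) dp1 dp2 (T1 : measurableType dp1)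
    (T2 : measurableType dp2) (nu : {sigma_finite_measure set T1 -> \bar R})
    (mu : {sigma_finite_measure set T2 -> \bar R}) (G : set (T1 * T2))
    (S : set T2) (E : set T1) (b tau : R) :
  measurable G -> measurable S -> measurable E -> 0 <= tau ->
  (forall y, S y -> (nu (ysection G y) <= b%:E)%E) ->
  (forall w, E w -> (tau%:E <= mu (xsection G w `&` S))%E) ->
  (tau%:E * nu E <= b%:E * mu S)%E.
Proof.
move=> mG mS mE tau0 Gb Etau; pose GS := G `&` snd @^-1` S.
have mGS : measurable GS.
  apply: measurableI => //.
  by rewrite -[X in measurable X]setTI; exact: measurable_snd.
have mx := measurable_fun_xsection mu mGS.
have my := measurable_fun_ysection nu mGS.
have -> : (tau%:E * nu E = \int[nu]_(w in E) tau%:E)%E by rewrite integral_cst.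
have -> : (b%:E * mu S = \int[mu]_(y in S) b%:E)%E by rewrite integral_cst.
apply: (@le_trans _ _ (\int[nu]_w mu (xsection GS w))%E).
  apply: (@le_trans _ _ (\int[nu]_(w in E) mu (xsection GS w))%E).
    apply: ge0_le_integral => //; first exact: measurable_funTS.
    by move=> w /Etau; rewrite xsectionI xsection_preimage_snd.
  exact: ge0_subset_integral.
have := indic_fubini_tonelli nu mu mGS.
rewrite indic_fubini_tonelli_FE// indic_fubini_tonelli_GE// => ->.
have outS y : ~ S y -> ysection GS y = set0.
  by move=> nSy; rewrite -subset0 => w /ysectionP[].
rewrite [leRHS]integral_mkcond; apply: ge0_le_integral => //.
  by apply/(measurable_restrictT _ mS); exact: measurable_cst.
move=> y _; rewrite patchE; case: ifPn => [/set_mem Sy|/negP nSy].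
  apply: le_trans (Gb y Sy); apply: le_measure; rewrite ?inE.
  - exact: measurable_ysection.
  - exact: measurable_ysection.
  by rewrite /GS ysectionI; exact: subIsetl.
by rewrite /= outS ?measure0// => Sy; apply: nSy; exact/mem_set.
Qed.

(** * The random cell in a fixed dimension *)

Section random_cell.
Context {R : realType} {disp : measure_display} {Om : measurableType disp}.
Context {P : probability Om R} {d n : nat}.
Variable X : 'I_n -> {RV P >-> euclid R d}.
Hypothesis Xunif : forall i, uniform_in unit_ball (X i).
Implicit Types (x z v : euclid R d) (w : Om) (a : \bar R) (m r t q : R).
Local Notation vol := (lebesgue_tuple d).
Local Notation bv := (ball_vol R d).

Definition cell w : set (euclid R d) := voronoi (range (X ^~ w)).

Definition cell_graph : set (Om * euclid R d) := [set p | cell p.1 p.2].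

Lemma cellP w x : cell w x <-> forall i, halfspace (X i w) x.
Proof. by split=> [Vx i|Vx _ [i _ <-]]; [apply: Vx; exists i|exact: Vx]. Qed.

Lemma measurable_cell_graph : measurable cell_graph.
Proof.
rewrite (_ : cell_graph =
    \bigcap_(i in [set: 'I_n]) [set p | halfspace (X i p.1) p.2]); last first.
  by apply/seteqP; split=> p; rewrite /cell_graph/= cellP => Vx i *; exact: Vx.
apply: fin_bigcap_measurable => // i _.
have mX : measurable_fun setT (fun p : Om * euclid R d => X i p.1).
  exact: measurableT_comp measurable_fst.
apply: measurable_set_ler; apply: measurableT_comp measurable_enorm _ => //.
exact: measurable_esub.
Qed.

Lemma xsection_cell_graph w : xsection cell_graph w = cell w.
Proof. by rewrite xsectionE. Qed.

Lemma measurable_cell w : measurable (cell w).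
Proof.
rewrite -xsection_cell_graph.
exact: measurable_xsection measurable_cell_graph.
Qed.

Lemma measurable_cell_vol : measurable_fun setT (fun w => vol (cell w)).
Proof.
under eq_fun do rewrite -xsection_cell_graph.
exact: measurable_fun_xsection measurable_cell_graph.
Qed.

Lemma measurable_cell_vol_lt a : measurable [set w | (vol (cell w) < a)%E].
Proof.
rewrite -[X in measurable X]setTI.
by apply: measurable_lte => //; exact: measurable_cell_vol.
Qed.

Lemma measurable_cell_vol_gt a : measurable [set w | (a < vol (cell w))%E].
Proof.
rewrite -[X in measurable X]setTI.
by apply: measurable_lte => //; exact: measurable_cell_vol.
Qed.

Lemma measurable_preimageX i (A : set (euclid R d)) :
  measurable A -> measurable (X i @^-1` A).
Proof.
by move=> mA; rewrite -[X in measurable X]setTI; exact: measurable_funP.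
Qed.

Lemma prob_uniform i (A : set (euclid R d)) : measurable A ->
  P (X i @^-1` A) = (vol (A `&` unit_ball) * (bv^-1)%:E)%E.
Proof.
move=> mA; have := Xunif i mA; rewrite /distribution /pushforward => ->.
by rewrite lebesgue_unit_ball inver gt_eqF// ball_vol_gt0.
Qed.

Definition excluding x : set (euclid R d) := [set v | ~ halfspace v x].

Lemma lens_excluding x : lens x = excluding x `&` unit_ball.
Proof.
congr (_ `&` _); apply/seteqP; split=> v; rewrite /excluding /halfspace/= ltNge.
  by move/negP.
by move/negP.
Qed.

Lemma measurable_excluding x : measurable (excluding x).
Proof.
apply: measurableC; apply: measurable_set_ler => //.
by apply: measurableT_comp measurable_enorm _; exact: measurable_esub.
Qed.

Lemma prob_excluding i x : P (X i @^-1` excluding x) = (lens_prob x)%:E.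
Proof.
rewrite prob_uniform; last exact: measurable_excluding.
by rewrite -lens_excluding lebesgue_lens -EFinM mulfK// gt_eqF// ball_vol_gt0.
Qed.

Lemma prob_bigcup_le (A : 'I_n -> set Om) q : (forall i, measurable (A i)) ->
  (forall i, P (A i) <= q%:E)%E -> (P (\bigcup_i A i) <= (n%:R * q)%:E)%E.
Proof.
move=> mA Aq; apply: le_trans (measure_fin_bigcup_le _ mA) _.
apply: (@le_trans _ _ (\sum_(i < n) q%:E)%E).
  by apply: lee_sum => i _; exact: Aq.
by rewrite sumEFin sumr_const card_ord mulr_natl.
Qed.

Lemma prob_notin_cell_le x :
  (P (ysection (~` cell_graph) x) <= (n%:R * lens_prob x)%:E)%E.
Proof.
rewrite (_ : ysection _ _ = \bigcup_i (X i @^-1` excluding x)).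
  apply: prob_bigcup_le => i; last by rewrite prob_excluding.
  exact: measurable_preimageX (measurable_excluding x).
apply/seteqP; split=> w => [/ysectionP/= /cellP/existsNP[i Vx]|[i _ Vx]].
  by exists i.
by apply/ysectionP => /cellP/(_ i).
Qed.

Definition short_vector m : set Om := \bigcup_i (X i @^-1` eball ezero m).

Lemma measurable_short_vector m : measurable (short_vector m).
Proof.
apply: fin_bigcup_measurable => // i _.
exact: measurable_preimageX (measurable_eball _ _).
Qed.

Lemma prob_short_vector_le m : 0 < m ->
  (P (short_vector m) <= (n%:R * m ^+ d)%:E)%E.
Proof.
move=> m0; apply: prob_bigcup_le => i.
  exact: measurable_preimageX (measurable_eball _ _).
rewrite prob_uniform; last exact: measurable_eball.
rewrite lee_pdivrMr ?ball_vol_gt0// -EFinM -(lebesgue_eball ezero m0).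
apply: le_measure; rewrite ?inE; last exact: subIsetl.
  by apply: measurableI measurable_unit_ball; exact: measurable_eball.
exact: measurable_eball.
Qed.

Lemma prob_cell_vol_lt r q : 0 < r ->
  (forall x, enorm x <= r -> lens_prob x <= q) ->
  (P [set w | (vol (cell w) < (r ^+ d * bv / 2)%:E)%E] <=
    (2 * (n%:R * q))%:E)%E.
Proof.
move=> r0 lensq; set tau := r ^+ d * bv / 2.
have tau0 : 0 < tau by rewrite divr_gt0// mulr_gt0 ?ball_vol_gt0// exprn_gt0.
pose B : set (euclid R d) := eball ezero r.
have volB : vol B = (tau + tau)%:E.
  by rewrite lebesgue_eball// /tau -splitr.
have mB : measurable B by exact: measurable_eball.
rewrite -(@lee_pmul2l _ tau%:E) ?lte_fin//.
have -> : (tau%:E * (2 * (n%:R * q))%:E = (n%:R * q)%:E * vol B)%E.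
  by rewrite volB -!EFinM; congr EFin; ring.
apply: (markov_xsection (G := ~` cell_graph)) => //.
- by apply: measurableC; exact: measurable_cell_graph.
- exact: measurable_cell_vol_lt.
- exact: ltW.
- rewrite /B eball_ezero => x /= xr; apply: le_trans (prob_notin_cell_le x) _.
  by rewrite lee_fin ler_wpM2l// lensq.
move=> w /= Vtau; rewrite xsectionE -preimage_setC -xsectionE.
rewrite xsection_cell_graph leNgt; apply/negP => VCtau.
suff : (vol B < (tau + tau)%:E)%E.
  by rewrite volB ltxx.
have mV := measurable_cell w; rewrite (measureDI vol mB mV) setDE setIC.
apply: lteD VCtau (le_lt_trans _ Vtau).
by apply: le_measure; rewrite ?inE//; exact: measurableI.
Qed.

Hypothesis Xindep : mutually_independent X.

Lemma prob_in_cell x : P (ysection cell_graph x) = ((1 - lens_prob x) ^+ n)%:E.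
Proof.
rewrite (_ : ysection _ _ = \bigcap_(i in [set` [set: 'I_n]%SET])
    (X i @^-1` (~` excluding x))); last first.
  apply/seteqP; split=> w => [/ysectionP/cellP Vx i _|Vx].
    by move=> /= /(_ (Vx i)).
  apply/ysectionP/cellP => i; apply: contrapT; apply: (Vx i).
  by rewrite /= inE.
rewrite Xindep => [|i]; last exact: measurableC (measurable_excluding x).
under eq_bigr => i _.
  rewrite -preimage_setC probability_setC ?prob_excluding ?EFinB; last first.
    exact: measurable_preimageX (measurable_excluding x).
  over.
by rewrite prodEFin prodr_const cardsT card_ord.
Qed.

Lemma prob_in_cell_le x q : q <= lens_prob x ->
  (P (ysection cell_graph x) <= (expR (- (n%:R * q)))%:E)%E.
Proof.
move=> qx; rewrite prob_in_cell lee_fin -(mulrN n%:R) expRM_natl.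
have p1 := lens_prob_le1 x; have := expR_ge1Dx (- q).
by move=> ?; apply: lerXn2r; rewrite ?nnegrE ?expR_ge0; lra.
Qed.

Lemma cell_shell_vol_ge m t r w : 0 < m <= 2 * r -> 0 < t <= 1 ->
  (forall i, m <= enorm (X i w)) -> ((r ^+ d * bv)%:E < vol (cell w))%E ->
  (((t * m / 2) ^+ d * bv)%:E <=
    vol (cell w `&` shell ((1 - t) * r - t * m / 2) r))%E.
Proof.
move=> /andP[m0 mr] /andP[t0 t1] Xm Vr; have r0 : 0 < r by lra.
have [z [Vz rz]] : exists z, cell w z /\ r < enorm z.
  apply/not_existsP => nz; move: Vr; rewrite ltNge => /negP; apply.
  rewrite -(lebesgue_eball ezero r0) eball_ezero.
  apply: le_measure; rewrite ?inE; first exact: measurable_cell.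
    by rewrite -eball_ezero; exact: measurable_eball.
  by move=> z Vz /=; rewrite leNgt; apply/negP => rz; apply: (nz z).
have [y sub] : exists y, eball y (t * m / 2) `<=`
    cell w `&` shell ((1 - t) * r - t * m / 2) r.
  apply: (voronoi_shell_eball r0 _ _ _ Vz (ltW rz)); [by lra|by lra|].
  by move=> v [i _ <-].
rewrite -(lebesgue_eball y) ?divr_gt0 ?mulr_gt0//.
apply: le_measure sub; rewrite inE; first exact: measurable_eball.
by apply: measurableI; [exact: measurable_cell|exact: measurable_shell].
Qed.

Lemma prob_cell_vol_gt_setD m t r q : 0 < m <= 2 * r -> 0 < t <= 1 ->
  (forall x, (1 - t) * r - t * m / 2 <= enorm x -> q <= lens_prob x) ->
  (P ([set w | ((r ^+ d * bv)%:E < vol (cell w))%E] `\` short_vector m) <=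
    ((r / (t * m / 2)) ^+ d * expR (- (n%:R * q)))%:E)%E.
Proof.
move=> mr t01 lensq; have [m0 r0 t0] : [/\ 0 < m, 0 < r & 0 < t] by split; lra.
set k := t * m / 2; have k0 : 0 < k by rewrite divr_gt0 ?mulr_gt0.
have kd0 : 0 < k ^+ d by rewrite exprn_gt0.
rewrite -(@lee_pmul2l _ (k ^+ d * bv)%:E) ?lte_fin ?mulr_gt0 ?ball_vol_gt0//.
have -> : ((k ^+ d * bv)%:E * ((r / k) ^+ d * expR (- (n%:R * q)))%:E =
    (expR (- (n%:R * q)))%:E * (r ^+ d * bv)%:E)%E.
  rewrite -!EFinM (expr_div_n r); congr EFin.
  by move: (r ^+ d) (k ^+ d) (lt0r_neq0 kd0) => x y y0; field.
apply: (@le_trans _ _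
    ((expR (- (n%:R * q)))%:E * vol (shell ((1 - t) * r - k) r))%E).
  apply: (markov_xsection measurable_cell_graph).
  - exact: measurable_shell.
  - apply: measurableD; first exact: measurable_cell_vol_gt.
    exact: measurable_short_vector.
  - by rewrite mulr_ge0 ?(ltW kd0) ?(ltW (@ball_vol_gt0 R d)).
  - by move=> x /andP[xr _]; exact/prob_in_cell_le/lensq.
  move=> w [Vr long]; rewrite xsection_cell_graph.
  apply: cell_shell_vol_ge => // i; rewrite leNgt; apply/negP => /ltW Xm.
  apply: long; exists i => //.
  by rewrite eball_ezero.
by apply: lee_wpmul2l; [rewrite lee_fin expR_ge0|exact: lebesgue_shell_le].
Qed.

Lemma prob_cell_vol_gt m t r q : 0 < m <= 2 * r -> 0 < t <= 1 ->
  (forall x, (1 - t) * r - t * m / 2 <= enorm x -> q <= lens_prob x) ->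
  (P [set w | ((r ^+ d * bv)%:E < vol (cell w))%E] <=
    (n%:R * m ^+ d + (r / (t * m / 2)) ^+ d * expR (- (n%:R * q)))%:E)%E.
Proof.
move=> mr t01 lensq; have m0 : 0 < m by case/andP: mr.
have mE := measurable_cell_vol_gt (r ^+ d * bv)%:E.
have mN := measurable_short_vector m.
rewrite (measureDI P mE mN) addeC EFinD; apply: leeD.
  apply: le_trans (prob_short_vector_le m0).
  by apply: le_measure; rewrite ?inE; [exact: measurableI| |exact: subIsetr].
exact: prob_cell_vol_gt_setD.
Qed.

End random_cell.

(** * Limits and events of high probability *)

Lemma exists_exprn_ge (R : archiRealFieldType) (Q A : R) :
  1 < Q -> exists k, A <= Q ^+ k.
Proof.
move=> Q1; have Q0 : 0 < Q by exact: lt_trans Q1.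
have Qi1 : `|Q^-1| < 1 by rewrite gtr0_norm ?invr_gt0// invf_lt1.
have d0 : 0 < (1 + `|A|)^-1 by rewrite invr_gt0 ltr_pwDl.
have [k _ /(_ k (leqnn k)) /=] := cvgr_le _ (cvg_expr Qi1) _ d0.
rewrite exprVn lef_pV2 ?posrE ?exprn_gt0 ?ltr_pwDl// => kQ.
by exists k; apply: le_trans kQ; rewrite (le_trans (ler_norm A))// lerDr.
Qed.

Lemma cvg_exprn_expRN (R : realType) (A Q c : R) : 1 < Q -> 0 < c ->
  A ^+ d * expR (- (c * Q ^+ d)) @[d --> \oo] --> 0.
Proof.
move=> Q1 c0; have Q0 : 0 < Q by exact: lt_trans Q1.
have [k Ak] := exists_exprn_ge `|A| Q1.
pose b := k.+1`!%:R / c ^+ k.+1.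
have Qi1 : `|Q^-1| < 1 by rewrite gtr0_norm ?invr_gt0// invf_lt1.
apply: norm_cvg0; apply: (squeeze_cvgr _ (cvg_cst 0) (cvg_geometric b Qi1)).
apply: nearW => d; rewrite normr_ge0/= normrM (gtr0_norm (expR_gt0 _)) normrX.
have Qd0 : 0 < Q ^+ d by rewrite exprn_gt0.
have expR_le : expR (- (c * Q ^+ d)) <= b / (Q ^+ d) ^+ k.+1.
  have cQ0 : 0 < c * Q ^+ d by rewrite mulr_gt0.
  rewrite expRN -mulrA -invfM -exprMn -[leRHS]invrK lef_pV2; last 2 first.
  - by rewrite posrE expR_gt0.
  - by rewrite posrE invr_gt0 divr_gt0 ?exprn_gt0 ?ltr0n ?fact_gt0.
  by rewrite invf_div; have := expR_ge1Dxn k (ltW cQ0); lra.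
have Ad : `|A| ^+ d <= (Q ^+ d) ^+ k.
  by rewrite -exprM mulnC exprM lerXn2r ?nnegrE ?exprn_ge0 ?(ltW Q0).
rewrite /geometric/=.
rewrite (_ : b * Q^-1 ^+ d = (Q ^+ d) ^+ k * (b / (Q ^+ d) ^+ k.+1)).
  by apply: ler_pM Ad expR_le; rewrite ?exprn_ge0 ?expR_ge0.
rewrite exprVn exprS.
move: (Q ^+ d) ((Q ^+ d) ^+ k) (lt0r_neq0 Qd0) (lt0r_neq0 (exprn_gt0 k Qd0)).
by move=> x y x0 y0; field; rewrite y0.
Qed.

Lemma mulr_cvg0_littleo (R : realType) (u v : nat -> R) :
  u d @[d --> \oo] --> 0 -> (fun d => u d * v d) =o_\oo v.
Proof.
move=> u0; apply/eqoP => e e0; near=> d; rewrite normrM ler_wpM2r//.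
by near: d; exact: cvgr0_norm_le.
Unshelve. all: by end_near. Qed.

Lemma diagonal_near (Q : nat -> nat -> Prop) :
  (forall k, \forall d \near \oo, Q k d) ->
  exists2 k : nat -> nat, k d @[d --> \oo] --> \oo &
    \forall d \near \oo, Q (k d) d.
Proof.
move=> nearQ; pose k d := \max_(i < d.+1 | `[< Q i d >]) (i : nat).
exists k.
  apply/cvgnyPge => K; near=> d.
  have Kd : (K < d.+1)%N by rewrite ltnS; near: d; exact: nbhs_infty_ge.
  have QK : Q K d by near: d; exact: nearQ.
  apply: (@leq_bigmax_cond _ _ (fun i : 'I_d.+1 => i : nat) (Ordinal Kd)).
  exact/asboolP.
near=> d.
have /asboolP Q0 : Q 0%N d by near: d; exact: nearQ.
rewrite /k (bigop.bigmax_eq_arg (ord0 : 'I_d.+1))//.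
by case: arg_maxnP => // i /asboolP.
Unshelve. all: by end_near. Qed.

Section pow_half_upto.
Context {R : realType}.
Implicit Types (c e t w : R) (v : \bar R) (d : nat).

Definition exponent_scale c : R := if c == 1 then 1 else ln c.

Lemma exponent_scale_neq0 c : 0 < c -> exponent_scale c != 0.
Proof.
by move=> c0; rewrite /exponent_scale; case: ifPn => [_|c1];
  rewrite ?oner_neq0// ln_eq0.
Qed.

Lemma pow_halfE c d t : 0 < c ->
  (if c == 1 then expR t else c `^ (d%:R / 2 + t)) =
  expR (t * exponent_scale c) * Num.sqrt c ^+ d.
Proof.
move=> c0; rewrite /exponent_scale; case: ifPn => [/eqP ->|_].
  by rewrite sqrtr1 expr1n !mulr1.
rewrite powRD ?(gt_eqF c0) ?implybT// [d%:R / 2]mulrC powRrM.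
rewrite powR12_sqrt ?(ltW c0)//.
by rewrite powR_mulrn ?sqrtr_ge0// mulrC /powR gt_eqF.
Qed.

Lemma pow_half_uptoP c d e v w : 0 < c -> 0 < w ->
  let l := `|exponent_scale c| in
  pow_half_upto c d e v w%:E <->
  ((expR (- (l * e)) * Num.sqrt c ^+ d * w)%:E <= v)%E /\
  (v <= (expR (l * e) * Num.sqrt c ^+ d * w)%:E)%E.
Proof.
move=> c0 w0 /=; set l := exponent_scale c.
have l0 : l != 0 by exact: exponent_scale_neq0.
have l_gt0 : 0 < `|l| by rewrite normr_gt0.
rewrite /pow_half_upto; set q := Num.sqrt c ^+ d * w.
have q0 : 0 < q by rewrite mulr_gt0// exprn_gt0// sqrtr_gt0.
rewrite -!mulrA -/q; split=> [[t te ->]|[]].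
  rewrite pow_halfE// -EFinM -mulrA -/q -/l !lee_fin !ler_pM2r// !ler_expR.
  by apply/andP; rewrite -ler_norml normrM mulrC ler_pM2l.
case: v => [v| |]; rewrite ?leye_eq ?leeNy_eq// !lee_fin => lo_v v_hi.
have v0 : 0 < v by apply: lt_le_trans lo_v; rewrite mulr_gt0// expR_gt0.
have vq0 : 0 < v / q by rewrite divr_gt0.
exists (ln (v / q) / l).
  rewrite normrM normfV ler_pdivrMr// [e * _]mulrC ler_norml.
  apply/andP; split; rewrite -ler_expR lnK ?posrE//.
    by rewrite ler_pdivlMr.
  by rewrite ler_pdivrMr.
rewrite pow_halfE// -/l divfK// lnK ?posrE// -EFinM -(mulrA (v / q)) -/q.
by rewrite divfK// gt_eqF.
Qed.

End pow_half_upto.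

Section with_high_probability.
Context {R : realType} {disp : nat -> measure_display}.
Context {Om : forall d, measurableType (disp d)}.
Context {P : forall d, probability (Om d) R}.
Implicit Types E F : forall d, set (Om d).

Lemma cvg_prob0 E (u : nat -> R) :
  (\forall d \near \oo, (P d (E d) <= (u d)%:E)%E) -> u d @[d --> \oo] --> 0 ->
  P d (E d) @[d --> \oo] --> 0%E.
Proof.
move=> Eu u0; have u0E : (u d)%:E @[d --> \oo] --> 0%E.
  by apply: cvg_EFin => //; exact: nearW.
apply: (squeeze_cvge _ (cvg_cst 0%E) u0E).
by apply: filterS Eu => d ->; rewrite measure_ge0.
Qed.

Lemma whp_cvg_prob_setC0 E : (forall d, measurable (E d)) ->
  P d (~` E d) @[d --> \oo] --> 0%E -> with_high_probability P E.
Proof.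
move=> mE CE0; split=> //.
have -> : (fun d => P d (E d)) = (fun d => 1 - P d (~` E d))%E.
  apply/funext => d; rewrite -probability_setC ?setCK//; exact: measurableC.
by rewrite -[X in _ --> X]sube0; apply: cvgeB => //; exact: cvg_cst.
Qed.

Lemma cvg_prob0U E F :
  (forall d, measurable (E d)) -> (forall d, measurable (F d)) ->
  P d (E d) @[d --> \oo] --> 0%E -> P d (F d) @[d --> \oo] --> 0%E ->
  P d (E d `|` F d) @[d --> \oo] --> 0%E.
Proof.
move=> mE mF E0 F0.
have EF0 : (P d (E d) + P d (F d))%E @[d --> \oo] --> 0%E.
  by rewrite -[X in _ --> X]adde0; exact: cvgeD.
apply: (squeeze_cvge _ (cvg_cst 0%E) EF0); apply: nearW => d.
by rewrite measure_ge0 measureU2.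
Qed.

Lemma whp_diagonal (E : nat -> forall d, set (Om d)) :
  (forall k, with_high_probability P (E k)) ->
  exists2 k : nat -> nat, k d @[d --> \oo] --> \oo &
    with_high_probability P (fun d => E (k d) d).
Proof.
move=> whpE; have mE k d : measurable (E k d) by have [] := whpE k.
have nearE k : \forall d \near \oo, ((1 - harmonic k)%:E <= P d (E k d))%E.
  have [_ /fine_cvgP[_ E1]] := whpE k.
  have : 1 - harmonic k < 1 :> R by rewrite ltrBlDr ltrDl harmonic_gt0.
  move=> /(cvgr_ge _ E1); apply: filterS => d /=.
  by rewrite -lee_fin fineK ?fin_num_measure.
have [k koo nearEk] := diagonal_near nearE; exists k => //; split=> //.
have low : (1 - harmonic (k d))%:E @[d --> \oo] --> (1%:E : \bar R).
  apply: cvg_EFin; first exact: nearW.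
  rewrite -[X in _ --> X]subr0; apply: cvgB; first exact: cvg_cst.
  exact: cvg_comp koo cvg_harmonic.
apply: (squeeze_cvge _ low (cvg_cst 1%E)).
by apply: filterS nearEk => d ->; rewrite probability_le1.
Qed.

End with_high_probability.

(** * Concentration of the volume *)

Lemma exists_radius_between (R : rcfType) (a c : R) : 0 < a ->
  1 < a ^+ 2 * c -> exists s, [/\ 0 < s, s ^+ 2 < c & 1 < a * s].
Proof.
move=> a0 ac; have ai0 : 0 < a^-1 by rewrite invr_gt0.
have c0 : 0 < c by rewrite -(pmulr_rgt0 _ (exprn_gt0 2 a0)) (lt_trans ltr01).
have ai_lt : a^-1 < Num.sqrt c.
  rewrite -[a^-1]gtr0_norm// -sqrtr_sqr ltr_sqrt// exprVn.
  by rewrite -div1r ltr_pdivrMr ?exprn_gt0// mulrC.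
have [s ais sc] : exists2 s, a^-1 < s & s < Num.sqrt c.
  by exists ((a^-1 + Num.sqrt c) / 2); lra.
have s0 : 0 < s by exact: lt_trans ais.
exists s; split=> //; last by rewrite mulrC -ltr_pdivrMr// div1r.
by rewrite -(sqr_sqrtr (ltW c0)) ltr_pXn2r ?nnegrE ?sqrtr_ge0// ltW.
Qed.

Lemma exists_shell_parameters (R : realFieldType) (a r s : R) : 0 < a ->
  0 < r -> r < s -> exists m t, [/\ 0 < m <= s, 0 < t <= 1, a * m <= 2^-1 &
                                   r <= (1 - t) * s - t * m / 2].
Proof.
move=> a0 r0 rs; have s0 : 0 < s by exact: lt_trans rs.
exists (Num.min (2 * a)^-1 s), ((s - r) / (2 * s)).
have ts : (s - r) / (2 * s) * s = (s - r) / 2 by field; lra.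
have t0 : 0 < (s - r) / (2 * s) by rewrite divr_gt0; lra.
split.
- by rewrite lt_min invr_gt0 mulr_gt0//= s0 ge_min lexx orbT.
- by rewrite t0 ler_pdivrMr; lra.
- by rewrite -ler_pdivlMl// -invfM mulrC ge_min lexx.
- have : (s - r) / (2 * s) * Num.min (2 * a)^-1 s <= (s - r) / 2.
    by rewrite -ts ler_pM2l// ge_min lexx orbT.
  lra.
Qed.

Section concentration.
Context {R : realType} {alpha : R} {disp : nat -> measure_display}.
Context {Om : forall d, measurableType (disp d)}.
Context {P : forall d, probability (Om d) R} {n : nat -> nat}.
Variable X : forall d, 'I_(n d) -> {RV (P d) >-> euclid R d}.
Hypothesis alpha1 : 1 < alpha.
Hypothesis nE : forall d, `|(n d)%:R - alpha ^+ d| < 1.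
Hypothesis Xunif : forall d (i : 'I_(n d)), uniform_in unit_ball (X i).
Hypothesis Xindep : forall d, mutually_independent (@X d).
Implicit Types r s : R.

Local Notation vol w := (lebesgue_tuple _ (cell (@X _) w)).

Let alpha0 : 0 < alpha.
Proof. exact: lt_trans alpha1. Qed.

Lemma sample_size_le d : (n d)%:R <= 2 * alpha ^+ d.
Proof.
have : 1 <= alpha ^+ d by rewrite exprn_ege1// ltW.
by have := nE d; rewrite ltr_norml => /andP[]; lra.
Qed.

Lemma near_sample_size_ge : \forall d \near \oo, alpha ^+ d / 2 <= (n d)%:R.
Proof.
have ai1 : `|alpha^-1| < 1 by rewrite gtr0_norm ?invr_gt0// invf_lt1.
near=> d; have : alpha^-1 ^+ d <= 2^-1.
  by near: d; apply: cvgr_le (cvg_expr ai1) _ _; rewrite invr_gt0.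
rewrite exprVn lef_pV2 ?posrE ?exprn_gt0//.
by have := nE d; rewrite ltr_norml => /andP[]; lra.
Unshelve. all: by end_near. Qed.

Lemma cvg_prob_vol_lt r s : 0 < s -> s < r ->
  alpha ^+ 2 * lens_rate (r ^+ 2) <= 1 ->
  P d [set w | (vol w < (s ^+ d * ball_vol R d)%:E)%E] @[d --> \oo] --> 0%E.
Proof.
move=> s0 sr rate_le1.
have [t st tr] : exists2 t, s < t & t < r by exists ((s + r) / 2); lra.
have t0 : 0 < t by exact: lt_trans st.
pose q := Num.sqrt (lens_rate (t ^+ 2)).
have aq : `|alpha * q| < 1.
  rewrite -ltr_sqr ?nnegrE// expr1n real_normK ?num_real// exprMn.
  rewrite sqr_sqrtr ?ltW ?lens_rate_gt0 ?exprn_gt0//.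
  apply: lt_le_trans rate_le1; rewrite ltr_pM2l ?exprn_gt0//.
  by apply: lens_rate_homo_lt; rewrite ltr_pXn2r ?nnegrE ?ltW//; lra.
have st1 : `|s / t| < 1 by rewrite gtr0_norm ?divr_gt0// ltr_pdivrMr ?mul1r.
apply: cvg_prob0 (cvg_geometric 4 aq); near=> d.
have st_half : (s / t) ^+ d <= 2^-1.
  by near: d; apply: cvgr_le (cvg_expr st1) _ _; rewrite invr_gt0.
have std : s ^+ d <= t ^+ d / 2.
  by move: st_half; rewrite expr_div_n ler_pdivrMr ?exprn_gt0//; lra.
apply: (@le_trans _ _
    (P d [set w | (vol w < (t ^+ d * ball_vol R d / 2)%:E)%E])).
  apply: le_measure; rewrite ?inE; [exact: measurable_cell_vol_lt..|].
  move=> w /= /lt_le_trans; apply; rewrite lee_fin mulrAC.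
  by rewrite ler_pM2r ?ball_vol_gt0.
have lensq (x : euclid R d) : enorm x <= t -> lens_prob x <= q ^+ d.
  exact: lens_prob_le.
apply: le_trans (prob_cell_vol_lt (@Xunif d) t0 lensq) _.
have qd0 : 0 <= q ^+ d by rewrite exprn_ge0 ?sqrtr_ge0.
by rewrite lee_fin exprMn; have := sample_size_le d; nra.
Unshelve. all: by end_near. Qed.

Lemma cvg_prob_vol_gt r s : 0 < r -> r < s ->
  1 <= alpha ^+ 2 * lens_rate (r ^+ 2) ->
  P d [set w | ((s ^+ d * ball_vol R d)%:E < vol w)%E] @[d --> \oo] --> 0%E.
Proof.
move=> r0 rs rate_ge1.
have [u ru us] : exists2 u, r < u & u < s by exists ((r + s) / 2); lra.
have u0 : 0 < u by exact: lt_trans ru.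
have s0 : 0 < s by exact: lt_trans us.
have rate_u : 1 < alpha ^+ 2 * lens_rate (u ^+ 2).
  apply: le_lt_trans rate_ge1 _; rewrite ltr_pM2l ?exprn_gt0//.
  by apply: lens_rate_homo_lt; rewrite ltr_pXn2r ?nnegrE ?ltW.
have [q [q0 qu aq]] := exists_radius_between alpha0 rate_u.
have [m [t [/andP[m0 ms] t01 am tu]]] := exists_shell_parameters alpha0 u0 us.
have k0 : 0 < t * m / 2 by rewrite !mulr_gt0 ?invr_gt0//; case/andP: t01.
have half1 : `|2^-1 : R| < 1 by rewrite gtr0_norm ?invr_gt0 ?invf_lt1 ?ltr1n.
have lim0 : 2 * 2^-1 ^+ d + (s / (t * m / 2)) ^+ d *
    expR (- (4^-1 * (alpha * q) ^+ d)) @[d --> \oo] --> 0.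
  rewrite -[X in _ --> X]addr0; apply: cvgD; first exact: cvg_geometric.
  by apply: cvg_exprn_expRN => //; rewrite invr_gt0.
apply: cvg_prob0 lim0; near=> d.
have lensq (x : euclid R d) : u <= enorm x -> q ^+ d / 2 <= lens_prob x.
  by move: x; near: d; exact: near_lens_prob_ge.
have nd : alpha ^+ d / 2 <= (n d)%:R by near: d; exact: near_sample_size_ge.
have ms2 : 0 < m <= 2 * s by rewrite m0; lra.
apply: le_trans (prob_cell_vol_gt (@Xunif d) (@Xindep d) ms2 t01
  (fun x ux => lensq x (le_trans tu ux))) _.
rewrite lee_fin lerD//.
  apply: (@le_trans _ _ (2 * alpha ^+ d * m ^+ d)).
    by rewrite ler_wpM2r ?sample_size_le// exprn_ge0// ltW.
  rewrite -mulrA -exprMn ler_pM2l// lerXn2r ?nnegrE ?invr_ge0//.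
  by rewrite ltW// mulr_gt0.
have sk0 : 0 <= s / (t * m / 2) by rewrite divr_ge0// ltW.
rewrite ler_wpM2l ?exprn_ge0// ler_expR lerN2 exprMn.
by have : 0 < q ^+ d; [rewrite exprn_gt0|nra].
Unshelve. all: by end_near. Qed.

Definition vol_within r eps d : set (Om d) := [set w |
  ((expR (- (eps * d%:R)) * r ^+ d * ball_vol R d)%:E <= vol w)%E /\
  (vol w <= (expR (eps * d%:R) * r ^+ d * ball_vol R d)%:E)%E].
Arguments vol_within r eps d : clear implicits.

Lemma whp_vol_within r eps : 0 < r -> alpha ^+ 2 * lens_rate (r ^+ 2) = 1 ->
  0 < eps -> with_high_probability P (vol_within r eps).
Proof.
move=> r0 critical eps0.
pose lo d : set (Om d) :=
  [set w | (vol w < (expR (- (eps * d%:R)) * r ^+ d * ball_vol R d)%:E)%E].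
pose hi d : set (Om d) :=
  [set w | ((expR (eps * d%:R) * r ^+ d * ball_vol R d)%:E < vol w)%E].
have mlo d : measurable (lo d) by exact: measurable_cell_vol_lt.
have mhi d : measurable (hi d) by exact: measurable_cell_vol_gt.
have vol_withinE d : vol_within r eps d = ~` (lo d `|` hi d).
  apply/seteqP; split=> w; rewrite /vol_within /lo /hi/=.
    by move=> [le_lo le_hi] []; rewrite ltNge ?le_lo ?le_hi.
  by move=> /not_orP[/negP + /negP]; rewrite -!leNgt.
apply: whp_cvg_prob_setC0 => [d|].
  by rewrite vol_withinE; apply: measurableC; exact: measurableU.
under eq_cvg => d do rewrite vol_withinE setCK.
apply: cvg_prob0U => //.
- under eq_cvg => d do rewrite /lo -mulNr expRM_natr -exprMn.
  apply: (@cvg_prob_vol_lt r); rewrite ?critical ?mulr_gt0 ?expR_gt0//.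
  by rewrite gtr_pMl// expR_lt1 oppr_lt0.
- under eq_cvg => d do rewrite /hi expRM_natr -exprMn.
  by apply: (@cvg_prob_vol_gt r); rewrite ?critical// ltr_pMl// expR_gt1.
Qed.

Lemma whp_voronoi_volume c : 0 < c -> alpha ^+ 2 * lens_rate c = 1 ->
  exists2 e : nat -> R, e =o_\oo (fun d : nat => d%:R : R) &
    with_high_probability P (fun d =>
      [set w | pow_half_upto c d (e d) (vol w) (lebesgue_tuple d unit_ball)]).
Proof.
move=> c0 critical; pose r := Num.sqrt c.
have r0 : 0 < r by rewrite sqrtr_gt0.
have {}critical : alpha ^+ 2 * lens_rate (r ^+ 2) = 1.
  by rewrite sqr_sqrtr// ltW.
have [k koo [mE E1]] := whp_diagonal
  (fun k => whp_vol_within r0 critical (harmonic_gt0 k)).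
pose l := `|exponent_scale c|.
have l0 : 0 < l by rewrite normr_gt0 exponent_scale_neq0.
exists (fun d => harmonic (k d) / l * d%:R).
  apply: mulr_cvg0_littleo; rewrite -(mul0r l^-1).
  by apply: cvgM (cvg_cst _); exact: cvg_comp koo cvg_harmonic.
have withinE d : [set w | pow_half_upto c d (harmonic (k d) / l * d%:R)
    (vol w) (lebesgue_tuple d unit_ball)] = vol_within r (harmonic (k d)) d.
  have lK : l * (harmonic (k d) / l * d%:R) = harmonic (k d) * d%:R.
    by field; rewrite gt_eqF.
  rewrite lebesgue_unit_ball /vol_within -lK.
  by apply/seteqP; split=> w /(pow_half_uptoP _ _ _ c0 (@ball_vol_gt0 R d)).
split=> [d|]; first by rewrite withinE.
by under eq_cvg do rewrite withinE.
Qed.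

End concentration.

Theorem theorem4 (R : realType) (alpha : R)
    (disp : nat -> measure_display)
    (Om : forall d : nat, measurableType (disp d))
    (P : forall d : nat, probability (Om d) R)
    (n : nat -> nat)
    (X : forall d : nat, 'I_(n d) -> {RV (P d) >-> euclid R d}) :
  1 < alpha ->
  (forall d : nat, `|(n d)%:R - alpha ^+ d| < 1) ->
  (forall (d : nat) (i : 'I_(n d)), uniform_in unit_ball (X d i)) ->
  (forall d : nat, mutually_independent (X d)) ->
  let L (d : nat) (w : Om d) : set (euclid R d) := range (fun i => X d i w) in
  let vol_is_pow (c : R) (e : nat -> R) (d : nat) : set (Om d) :=
    [set w | pow_half_upto c d (e d)
       (lebesgue_tuple d (voronoi (L d w))) (lebesgue_tuple d unit_ball)] in
  (alpha <= Num.sqrt 2 ->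
    exists2 e : nat -> R, e =o_\oo (fun d : nat => d%:R : R) &
      with_high_probability P
        (vol_is_pow (alpha ^+ 2 / (4 * alpha ^+ 2 - 4)) e)) /\
  (Num.sqrt 2 <= alpha ->
    exists2 e : nat -> R, e =o_\oo (fun d : nat => d%:R : R) &
      with_high_probability P (vol_is_pow (1 / alpha ^+ 2) e)).
Proof.
move=> alpha1 nE Xunif Xindep L vol_is_pow.
have alpha0 : 0 < alpha by exact: lt_trans alpha1.
have alpha2_gt1 : 1 < alpha ^+ 2 by rewrite exprn_egt1.
have sqrt2_sqr : Num.sqrt 2 ^+ 2 = 2 :> R by rewrite sqr_sqrtr.
split=> alpha_sqrt2; apply: (whp_voronoi_volume alpha1 nE Xunif Xindep).
- by rewrite divr_gt0 ?exprn_gt0//; lra.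
- apply: lens_rate_critical_le2 => //.
  by rewrite -sqrt2_sqr lerXn2r ?nnegrE ?sqrtr_ge0// ltW.
- by rewrite divr_gt0 ?exprn_gt0.
- apply: lens_rate_critical_ge2.
  by rewrite -sqrt2_sqr lerXn2r ?nnegrE ?sqrtr_ge0// ltW.
Qed.
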